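(* For any map $\iota_X\colon A\to X$ and any integer $k\ge 0$, $$\operatorname{relcat}_k\iota_X\;\le\;\operatorname{relcat}_{k+1}\iota_X\;\le\;\operatorname{relcat}_k\iota_X+1 .$$
   Context: Spaces are topological spaces; $\simeq$ denotes homotopy of maps, and all squares below commute up to homotopy. Ganea construction. For a map $\iota_X\colon A\to X$, define maps $g_i=g_i(\iota_X)\colon G_i=G_i(\iota_X)\to X$ for $i\ge 0$ inductively. Start with $G_0=A$ and $g_0=\iota_X$. Given $g_i$, let $F_i$ be the homotopy pullback of $g_i\colon G_i\to X$ and $\iota_X\colon A\to X$, with projections $\beta_i\colon F_i\to G_i$ and $\eta_i\colon F_i\to A$. Let $G_{i+1}$ be the homotopy pushout of $\beta_i$ and $\eta_i$, with structure maps $\gamma_i\colon G_i\to G_{i+1}$ and $\alpha_{i+1}\colon A\to G_{i+1}$. Let $g_{i+1}\colon G_{i+1}\to X$ be the map induced by $g_i$, $\iota_X$ and the homotopy of the pullback square, so that $g_{i+1}\circ\gamma_i\simeq g_i$ and $g_{i+1}\circ\alpha_{i+1}\simeq\iota_X$. That is, $g_{i+1}$ is the join of $g_i$ and $\iota_X$ over $X$. For $0\le k< i$ let $\gamma_{k,i}\simeq \gamma_{i-1}\circ\cdots\circ\gamma_{k+1}\circ\gamma_k\colon G_k\to G_i$, and $\gamma_{k,k}=\mathrm{id}_{G_k}$. (Equivalently, by associativity of the join, $G_i$ is the homotopy pushout of the two projections from the homotopy pullback of $g_k$ and $g_{i-k-1}$, and $\gamma_{k,i}$ is the structure map from $G_k$.)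 A homotopy section of $g_n\colon G_n\to X$ is a map $\sigma\colon X\to G_n$ with $g_n\circ\sigma\simeq\mathrm{id}_X$. $\operatorname{relcat}_k\iota_X$ (relative category of order $k$) is the least integer $n\ge k$ such that $g_n$ has a homotopy section $\sigma$ with $\sigma\circ g_k\simeq\gamma_{k,n}$; it is $\infty$ if no such integer exists. *)

(* Defs.v *)
From HB Require Import structures.
From Stdlib Require Import Relation_Operators.
From mathcomp Require Import all_boot all_order all_algebra generic_quotient.
From mathcomp Require Import all_classical reals constructive_ereal topology.
From mathcomp Require Import normedtype.

Set Implicit Arguments.
Unset Strict Implicit.
Unset Printing Implicit Defensive.

Import Order.TTheory GRing.Theory Num.Theory.
Import numFieldNormedType.Exports.
Local Open Scope classical_set_scope.
Local Open Scope ring_scope.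
Local Open Scope quotient_scope.

Section unit_interval.
Variable R : realType.

Definition unit_interval : topologicalType := set_type (`[0, 1]%classic : set R).

Lemma I0_subproof : `[0, 1]%classic (0 : R).
Proof. by rewrite /= in_itv /= lexx ler01. Qed.

Lemma I1_subproof : `[0, 1]%classic (1 : R).
Proof. by rewrite /= in_itv /= lexx ler01. Qed.

Definition I0 : unit_interval := SigSub (mem_set I0_subproof).
Definition I1 : unit_interval := SigSub (mem_set I1_subproof).

Lemma clamp_itv (x : R) : `[0, 1]%classic (Num.max 0 (Num.min x 1)).
Proof. by rewrite /= in_itv /= le_max lexx /= ge_max ler01 ge_min lexx orbT. Qed.
Definition clamp (x : R) : unit_interval := SigSub (mem_set (clamp_itv x)).
Lemma clamp_cont : continuous clamp.
Proof.
apply: continuous_comp_initial.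
rewrite (_ : _ \o _ = (fun x : R => Num.max 0 (Num.min x 1))); last by [].
move=> x; apply: (@continuous_max R R (cst 0) (fun x => Num.min x 1)); first exact: cvg_cst.
apply: (@continuous_min R R id (cst 1)); first exact: cvg_id.
exact: cvg_cst.
Qed.

Lemma unit_interval_compact : compact [set: unit_interval].
Proof.
rewrite (_ : setT = clamp @` `[0, 1]%classic).
  apply: continuous_compact; last exact: segment_compact.
  exact/continuous_subspaceT/clamp_cont.
rewrite eqEsubset; split => // -[x xP] _.
have := set_mem xP; rewrite /= in_itv /= => /andP[x0 x1].
exists x; first by rewrite /= in_itv /= x0.
by apply: eq_sig_hprop => //=; rewrite min_l // max_r.
Qed.

Lemma unit_interval_regular : regular_space (unit_interval).
Proof. exact: (@uniform_regular (set_type (`[0, 1]%classic : set R))). Qed.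

Lemma unit_interval_locally_compact : locally_compact [set: unit_interval].
Proof.
move=> x _; rewrite withinET; exists setT; first exact: filterT.
by split; [exact: unit_interval_compact|exact: closedT].
Qed.

End unit_interval.
Arguments I0 {R}.
Arguments I1 {R}.

(* Since H is continuous, this forces f and g to be continuous. *)
Definition homotopic (R : realType) (Y Z : topologicalType) (f g : Y -> Z) :=
  exists H : Y * unit_interval R -> Z,
    [/\ continuous H, forall y, H (y, I0) = f y & forall y, H (y, I1) = g y].

Section path_space.
Import ArrowAsCompactOpen.

(* All paths in X, with free endpoints, in the compact-open topology. *)
Definition path_space (R : realType) (X : topologicalType) : topologicalType :=
  continuousType (unit_interval R) X.

Definition path_fun (R : realType) (X : topologicalType) (w : path_space R X) :
  unit_interval R -> X := (w : continuousType _ _).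

Lemma path_eval_continuous (R : realType) (X : topologicalType) :
  continuous (fun wt : path_space R X * unit_interval R => path_fun wt.1 wt.2).
Proof.
rewrite (_ : (fun _ => _) = @eval (unit_interval R) X).
  exact: (eval_continuous (@unit_interval_locally_compact R) (@unit_interval_regular R)).
by apply/funext => -[].
Qed.

End path_space.

Section hpullback.
Context (R : realType) (B C X : topologicalType) (f : B -> X) (g : C -> X).

Definition hpullback : topologicalType :=
  set_type [set z : B * C * path_space R X |
    path_fun z.2 I0 = f z.1.1 /\ path_fun z.2 I1 = g z.1.2].

Definition hpb_fst (z : hpullback) : B := (set_val z).1.1.
Definition hpb_snd (z : hpullback) : C := (set_val z).1.2.
Definition hpb_path (z : hpullback) : path_space R X := (set_val z).2.

Lemma hpb_path0 z : path_fun (hpb_path z) I0 = f (hpb_fst z).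
Proof. by case: (set_valP z). Qed.

Lemma hpb_path1 z : path_fun (hpb_path z) I1 = g (hpb_snd z).
Proof. by case: (set_valP z). Qed.

End hpullback.

(* The homotopy pushout of p : F -> B and q : F -> C is the double mapping    *)
(* cylinder: the disjoint union of B, F * [0, 1] and C, with (z, 0) glued to  *)
(* p z and (z, 1) glued to q z. The library has no topology on B + C, whence  *)
(* a sigma type over a three-element index type.                              *)
Section hpushout.
Context (R : realType) (F B C : topologicalType) (p : F -> B) (q : F -> C).

Definition cyl_piece (i : option bool) : topologicalType :=
  match i with
  | None => (F * unit_interval R)%type
  | Some true => B
  | Some false => C
  end.

Definition cyl : topologicalType := {i & cyl_piece i}.

Definition cyl_left (b : B) : cyl := existT cyl_piece (Some true) b.
Definition cyl_right (c : C) : cyl := existT cyl_piece (Some false) c.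
Definition cyl_mid (z : F) (t : unit_interval R) : cyl :=
  existT cyl_piece None (z, t).

Inductive cyl_glue : cyl -> cyl -> Prop :=
| cyl_glue0 z : cyl_glue (cyl_mid z I0) (cyl_left (p z))
| cyl_glue1 z : cyl_glue (cyl_mid z I1) (cyl_right (q z)).

Definition cyl_equiv (x y : cyl) : bool := `[< clos_refl_sym_trans _ cyl_glue x y >].

Lemma cyl_equiv_refl : reflexive cyl_equiv.
Proof. by move=> x; apply/asboolP; exact: rst_refl. Qed.

Lemma cyl_equiv_sym : symmetric cyl_equiv.
Proof. by move=> x y; apply: asbool_equiv_eq; split; exact: rst_sym. Qed.

Lemma cyl_equiv_trans : transitive cyl_equiv.
Proof.
by move=> y x z /asboolP xy /asboolP yz; apply/asboolP; exact: rst_trans xy yz.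
Qed.

Canonical cyl_equivrel :=
  EquivRel cyl_equiv cyl_equiv_refl cyl_equiv_sym cyl_equiv_trans.

Definition hpushout : topologicalType := quotient_topology {eq_quot cyl_equivrel}.

Definition hpo_pi (x : cyl) : hpushout := \pi_{eq_quot cyl_equivrel} x.
Definition hpo_left (b : B) : hpushout := hpo_pi (cyl_left b).
Definition hpo_right (c : C) : hpushout := hpo_pi (cyl_right c).
Definition hpo_mid (z : F) (t : unit_interval R) : hpushout :=
  hpo_pi (cyl_mid z t).

(* The map induced by f : B -> X, g : C -> X and a homotopy h from f \o p to  *)
(* g \o q; it is independent of the choice of representatives by hpo_rec_pi.  *)
Section induced_map.
Context (X : Type) (f : B -> X) (g : C -> X) (h : F -> unit_interval R -> X).

Definition cyl_rec (x : cyl) : X :=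
  match x with
  | existT None zt => h zt.1 zt.2
  | existT (Some true) b => f b
  | existT (Some false) c => g c
  end.

Definition hpo_rec (x : hpushout) : X :=
  cyl_rec (repr (x : {eq_quot cyl_equivrel})).

Hypothesis h0 : forall z, h z I0 = f (p z).
Hypothesis h1 : forall z, h z I1 = g (q z).

Lemma hpo_rec_pi x : hpo_rec (hpo_pi x) = cyl_rec x.
Proof.
rewrite /hpo_rec /hpo_pi; case: piP => y /eqmodP/asboolP.
elim=> [_ _ [z|z]|//|? ? _ ->|? ? ? _ -> _ ->] //=.
Qed.

End induced_map.
End hpushout.

Record space_over (X : topologicalType) := Over {
  over_space : topologicalType;
  over_map : over_space -> X
}.
Arguments over_map {X} s _.
Arguments Over {X over_space} over_map.

Section join.
Context (R : realType) (X : topologicalType) (E E' : space_over X).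

Let F : topologicalType := hpullback R (over_map E) (over_map E').
Let beta : F -> over_space E := @hpb_fst _ _ _ _ (over_map E) (over_map E').
Let eta : F -> over_space E' := @hpb_snd _ _ _ _ (over_map E) (over_map E').

Definition join_total : topologicalType := hpushout R beta eta.

Definition join_proj : join_total -> X :=
  hpo_rec (over_map E) (over_map E') (fun z : F => path_fun (hpb_path z)).

Definition join_over : space_over X := Over join_proj.

Definition join_left : over_space E -> over_space join_over := hpo_left R beta eta.
Definition join_right : over_space E' -> over_space join_over := hpo_right R beta eta.

Lemma join_proj_left x : over_map join_over (join_left x) = over_map E x.
Proof. by apply: hpo_rec_pi; [exact: hpb_path0|exact: hpb_path1]. Qed.

Lemma join_proj_right x : over_map join_over (join_right x) = over_map E' x.
Proof. by apply: hpo_rec_pi; [exact: hpb_path0|exact: hpb_path1]. Qed.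

Lemma join_left_continuous : continuous join_left.
Proof.
move=> x; apply: (@continuous_comp _ _ _ (@cyl_left R _ _ _) (hpo_pi _ _)).
  exact: existT_continuous.
exact: pi_continuous.
Qed.

Lemma join_proj_continuous :
  continuous (over_map E) -> continuous (over_map E') ->
  continuous (over_map join_over).
Proof.
move=> cE cE'; apply/quotient_continuous.
have -> : over_map join_over \o \pi_(quotient_topology _) =
    cyl_rec (over_map E) (over_map E') (fun z : F => path_fun (hpb_path z)).
  by apply/funext => x; apply: hpo_rec_pi; [exact: hpb_path0|exact: hpb_path1].
have cpath : continuous (fun z : F => hpb_path z).
  move=> y; apply: (@continuous_comp _
    (over_space E * over_space E' * path_space R X)%type _ (@set_val _ _) snd).
    exact: (@initial_continuous _ _ (@set_val _ _)).
  by case: (set_val y) => u v; exact: cvg_snd.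
case=> [[[]|] x] U /= nU; [exact: (cE _ _ nU)|exact: (cE' _ _ nU)|].
case: x nU => z t nU.
have h1 : hpb_path zt.1 @[zt --> ((z, t) : F * unit_interval R)] --> hpb_path z.
  by apply: (@continuous_comp _ _ _ fst); [exact: cvg_fst|exact: cpath].
have h2 : zt.2 @[zt --> ((z, t) : F * unit_interval R)] --> t by exact: cvg_snd.
have := @continuous_comp _ (path_space R X * unit_interval R)%type _
  (fun zt : F * unit_interval R => (hpb_path zt.1, zt.2))
  (fun wt => path_fun wt.1 wt.2) (z, t) (cvg_pair h1 h2).
by move=> /(_ _ _ _ (@path_eval_continuous R X _)) /(_ U nU).
Qed.

End join.

Section ganea.
Context (R : realType) (A X : topologicalType) (iota : A -> X).

Fixpoint ganea (i : nat) : space_over X :=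
  if i is i'.+1 then join_over R (ganea i') (Over iota) else Over iota.

Definition ganea_space (i : nat) : topologicalType := over_space (ganea i).

Definition ganea_map (i : nat) : ganea_space i -> X := over_map (ganea i).

Definition ganea_incl (i : nat) : ganea_space i -> ganea_space i.+1 :=
  @join_left R X (ganea i) (Over iota).

Lemma ganea_incl_continuous i : continuous (@ganea_incl i).
Proof. exact: join_left_continuous. Qed.

Lemma ganea_map_continuous i : continuous iota -> continuous (@ganea_map i).
Proof.
by move=> ciota; elim: i => [|i IH] //; exact: join_proj_continuous.
Qed.

(* ganea_incl_iter k d is gamma_{k, d + k}. *)
Fixpoint ganea_incl_iter (k d : nat) : ganea_space k -> ganea_space (d + k) :=
  if d is d'.+1 then @ganea_incl (d' + k) \o @ganea_incl_iter k d' else id.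

(* The constraint n >= k takes the form n = d + k, in which gamma_{k, n} is   *)
(* well typed.                                                                *)
Definition relcat_section (k n : nat) : Prop :=
  exists2 d : nat, n = (d + k)%N &
  exists sigma : X -> ganea_space (d + k),
    [/\ continuous sigma,
        homotopic R (@ganea_map (d + k) \o sigma) id &
        homotopic R (sigma \o @ganea_map k) (@ganea_incl_iter k d)].

(* The least n satisfying relcat_section k, or +oo if there is none.          *)
Definition relcat (k : nat) : \bar int :=
  if pselect (exists n, `[< relcat_section k n >]) is left ex
  then (ex_minn ex)%:Z%:E else +oo%E.

End ganea.

(* Main.v *)
Require Import Defs.
From Stdlib Require Import Relation_Operators.
From mathcomp Require Import all_boot all_order all_algebra.
From mathcomp Require Import all_classical reals constructive_ereal topology.
From mathcomp Require Import normedtype generic_quotient.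
From mathcomp Require Import lra.

Set Implicit Arguments.
Unset Strict Implicit.
Unset Printing Implicit Defensive.

Import Order.TTheory GRing.Theory Num.Theory.
Import numFieldNormedType.Exports.

(* Write G_k = E, G_n = Y, with projections q and p to X. The first inequality *)
(* holds with the same section, since g_(k+1) \o gamma_k = g_k.               *)
(* For the second one, let sigma : X -> Y, K : p \o sigma ~ id and            *)
(* L : sigma \o q ~ gamma_(k,n). Then gamma_n \o sigma is a section of        *)
(* g_(n+1), and both gamma_n \o sigma \o g_(k+1) and gamma_(k+1,n+1) are      *)
(* homotopic to the join of gamma_(k,n) and id_A, as maps from E * A to Y * A. *)
(* The main tool is that for T : E * A -> Y with p \o T ~ g_(k+1), the map     *)
(* gamma_n \o T is homotopic to the join of T \o gamma_k and id_A; moving      *)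
(* T \o gamma_k = sigma \o q to gamma_(k,n) along L is then possible once L    *)
(* has been preceded by the sigma-image of the self-homotopy (p L)^-1 K of q,  *)
(* which makes p L agree with K up to homotopy.                                *)

(** The lower bound is a restriction: the homotopy required at order k+1, composed with [gamma_k],
    is the one required at order k ([relcat_section_pred]). For the upper bound
    ([relcat_section_succ]), one more join with A leaves room to deform. In Y * A every point of Y
    can slide along a segment towards A, so a map T : E * A -> Y that is compatible with the
    projections up to homotopy becomes, after [join_left], homotopic to a map determined by T on E
    and by paths in X ([join_left_homotopic]). Maps of this kind are the [join_lift]s; they are
    compared by deforming the map on E together with the paths ([join_lift_homotopic]). Both sides
    of the required homotopy reduce to the join of [gamma_(k,n)] with the identity of A: the section
    side by [join_section_homotopic], the inclusion by [iterated_incl_join_lift]. *)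

Section continuity.
Local Open Scope classical_set_scope.
Local Open Scope ring_scope.

Lemma continuous_compose (T U V : topologicalType) (f : T -> U) (g : U -> V) :
  continuous f -> continuous g -> continuous (fun x => g (f x)).
Proof. by move=> cf cg x; apply: continuous_comp; [exact: cf|exact: cg]. Qed.

Lemma continuous_pair (T U V : topologicalType) (f : T -> U) (g : T -> V) :
  continuous f -> continuous g -> continuous (fun x => (f x, g x)).
Proof. by move=> cf cg x; apply: cvg_pair; [exact: cf|exact: cg]. Qed.

Lemma continuous_fst (U V : topologicalType) :
  continuous (fst : U * V -> U).
Proof. by move=> [x y]; exact: cvg_fst. Qed.

Lemma continuous_snd (U V : topologicalType) :
  continuous (snd : U * V -> V).
Proof. by move=> [x y]; exact: cvg_snd. Qed.

Lemma continuous_idfun (T : topologicalType) : continuous (fun x : T => x).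
Proof. by move=> x; exact: cvg_id. Qed.

Lemma continuous_const (T U : topologicalType) (c : U) :
  continuous (fun _ : T => c).
Proof. by move=> x; exact: cvg_cst. Qed.

(** Pasting along the closed sets phi <= 0 and 0 <= phi, which meet only where phi = 0; every
    concatenation of homotopies or paths below is written in this form. *)
Lemma continuous_paste (R : realType) (T U : topologicalType)
    (phi : T -> R) (f g : T -> U) :
  continuous phi -> continuous f -> continuous g ->
  (forall x, phi x = 0 -> f x = g x) ->
  continuous (fun x => if phi x <= 0 then f x else g x).
Proof.
move=> cphi cf cg fg.
have AB : [set x | phi x <= 0] `|` [set x | 0 <= phi x] = setT.
  by rewrite -subTset => x _ /=; case: (leP (phi x) 0) => [|/ltW]; [left|right].
apply/continuous_subspace_setT; rewrite -AB.
apply: withinU_continuous.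
- exact: (closed_comp (fun x _ => cphi x) (@closed_le R 0)).
- exact: (closed_comp (fun x _ => cphi x) (@closed_ge R 0)).
- apply: (@subspace_eq_continuous _ _ _ f); last exact: continuous_subspaceT.
  by move=> x; rewrite inE /= /from_subspace => ->.
- apply: (@subspace_eq_continuous _ _ _ g); last exact: continuous_subspaceT.
  move=> x; rewrite inE /= /from_subspace => x0; case: ifPn => // x0'.
  by apply/esym/fg/le_anti; rewrite x0 x0'.
Qed.

End continuity.

Section real_continuity.
Local Open Scope ring_scope.
Context (R : realType) (T : topologicalType).
Implicit Types f g : T -> R.

Lemma continuous_addr f g :
  continuous f -> continuous g -> continuous (fun x => f x + g x).
Proof. by move=> cf cg x; apply: cvgD; [exact: cf|exact: cg]. Qed.

Lemma continuous_oppr f : continuous f -> continuous (fun x => - f x).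
Proof. by move=> cf x; apply: cvgN; exact: cf. Qed.

Lemma continuous_mulr f g :
  continuous f -> continuous g -> continuous (fun x => f x * g x).
Proof. by move=> cf cg x; apply: cvgM; [exact: cf|exact: cg]. Qed.

Lemma continuous_maxr f g :
  continuous f -> continuous g -> continuous (fun x => Num.max (f x) (g x)).
Proof. by move=> cf cg x; apply: continuous_max; [exact: cf|exact: cg]. Qed.

Lemma continuous_minr f g :
  continuous f -> continuous g -> continuous (fun x => Num.min (f x) (g x)).
Proof. by move=> cf cg x; apply: continuous_min; [exact: cf|exact: cg]. Qed.

End real_continuity.

(** * Real coordinates on the unit interval *)

Section unit_interval_coordinates.
Local Open Scope ring_scope.
Variable R : realType.
Implicit Types (t : unit_interval R) (x : R).

(** Reparametrizations are computed in R through [ival] and brought back by [clamp], which also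
    extends paths by constants beyond their ends. *)
Definition ival t : R := set_val t.

Lemma ival_continuous : continuous ival.
Proof. exact: (@initial_continuous _ _ (@set_val _ _)). Qed.

Lemma ival_ge0 t : 0 <= ival t.
Proof. by have := set_valP t; rewrite /= in_itv /= => /andP[]. Qed.

Lemma ival_le1 t : ival t <= 1.
Proof. by have := set_valP t; rewrite /= in_itv /= => /andP[]. Qed.

Lemma ival0 : ival I0 = 0. Proof. by []. Qed.

Lemma ival1 : ival I1 = 1. Proof. by []. Qed.

Lemma ival_inj : injective ival.
Proof. exact: val_inj. Qed.

Lemma ival_clamp x : ival (clamp x) = Num.max 0 (Num.min x 1).
Proof. by []. Qed.

Lemma ivalK t : clamp (ival t) = t.
Proof.
by apply: ival_inj; rewrite ival_clamp min_l ?ival_le1// max_r ?ival_ge0.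
Qed.

Lemma clamp_le0 x : x <= 0 -> clamp x = I0.
Proof.
move=> x0; apply: ival_inj; rewrite ival_clamp ival0 max_l//.
by rewrite ge_min x0.
Qed.

Lemma clamp_ge1 x : 1 <= x -> clamp x = I1.
Proof. by move=> x1; apply: ival_inj; rewrite ival_clamp min_r// max_r. Qed.

End unit_interval_coordinates.

(** * Exponential law, homotopy pullbacks and homotopy pushouts *)

Section mapping_spaces.
Local Open Scope classical_set_scope.
Variable R : realType.

Import ArrowAsCompactOpen.

Lemma path_curry (T Z : topologicalType) (g : T * unit_interval R -> Z) :
  continuous g ->
  exists2 G : T -> path_space R Z,
    continuous G & forall x t, path_fun (G x) t = g (x, t).
Proof.
move=> cg; have [cG cGx] := continuous_curry cg.
pose G x : path_space R Z := mkcts (cGx x).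
exists G => //.
exact: (@continuous_comp_initial _ _ _ (id : continuousType _ _ -> (_ -> _))).
Qed.

Lemma path_space_ext (Z : topologicalType) (v w : path_space R Z) :
  (forall t, path_fun v t = path_fun w t) -> v = w.
Proof.
by move=> vw; apply/continuousEP => t; exact: vw.
Qed.

End mapping_spaces.

Section homotopy_pullback.
Variables (R : realType) (B C X : topologicalType) (f : B -> X) (g : C -> X).
Notation P := (hpullback R f g).

Lemma set_val_hpullback_continuous :
  continuous (set_val : P -> B * C * path_space R X).
Proof. exact: (@initial_continuous _ _ (@set_val _ _)). Qed.

Lemma hpb_fst_continuous : continuous (@hpb_fst R B C X f g).
Proof.
apply: (continuous_compose (U := (B * C)%type) _ (@continuous_fst _ _)).
apply: (continuous_compose _ (@continuous_fst _ _)).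
exact: set_val_hpullback_continuous.
Qed.

Lemma hpb_snd_continuous : continuous (@hpb_snd R B C X f g).
Proof.
apply: (continuous_compose (U := (B * C)%type) _ (@continuous_snd _ _)).
apply: (continuous_compose _ (@continuous_fst _ _)).
exact: set_val_hpullback_continuous.
Qed.

Lemma hpb_path_continuous : continuous (@hpb_path R B C X f g).
Proof.
apply: (continuous_compose _ (@continuous_snd _ _)).
exact: set_val_hpullback_continuous.
Qed.

Lemma continuous_hpb_eval (T : topologicalType) (h : T -> P)
    (t : T -> unit_interval R) :
  continuous h -> continuous t ->
  continuous (fun x => path_fun (hpb_path (h x)) (t x)).
Proof.
move=> ch ct.
apply: (continuous_compose (f := fun x => (hpb_path (h x), t x))
  _ (@path_eval_continuous R X)).
apply: continuous_pair ct.
exact: continuous_compose ch hpb_path_continuous.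
Qed.

Lemma hpb_ext (y z : P) :
  hpb_fst y = hpb_fst z -> hpb_snd y = hpb_snd z ->
  (forall t, path_fun (hpb_path y) t = path_fun (hpb_path z) t) -> y = z.
Proof.
move=> e1 e2 /path_space_ext e3; apply: val_inj => /=.
move: e1 e2 e3; rewrite /hpb_fst /hpb_snd /hpb_path.
have -> : \val y = set_val y by []. have -> : \val z = set_val z by [].
by case: (set_val y) (set_val z) => [[? ?] ?] [[? ?] ?] /= -> -> ->.
Qed.

(** Universal property of the homotopy pullback for strictly matching end points; continuity of the
    path component is [path_curry]. *)
Lemma hpb_lift (T : topologicalType) (b : T -> B) (c : T -> C)
    (v : T * unit_interval R -> X) :
  continuous b -> continuous c -> continuous v ->
  (forall x, v (x, I0) = f (b x)) -> (forall x, v (x, I1) = g (c x)) ->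
  exists h : T -> P, [/\ continuous h,
    forall x, hpb_fst (h x) = b x, forall x, hpb_snd (h x) = c x &
    forall x t, path_fun (hpb_path (h x)) t = v (x, t)].
Proof.
move=> cb cc cv v0 v1; have [V cV VE] := path_curry cv.
have hP x : [set z : B * C * path_space R X |
    path_fun z.2 I0 = f z.1.1 /\ path_fun z.2 I1 = g z.1.2]%classic
    (b x, c x, V x).
  by rewrite /= !VE v0 v1.
pose h x : P := SigSub (mem_set (hP x)).
exists h; split => //.
apply: continuous_comp_initial.
rewrite (_ : _ \o _ = fun x => (b x, c x, V x)) //.
by apply: continuous_pair cV; exact: continuous_pair.
Qed.

End homotopy_pullback.

Section homotopy_pushout.
Local Open Scope quotient_scope.
Variables (R : realType) (F B C : topologicalType) (p : F -> B) (q : F -> C).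
Notation Q := (hpushout R p q).

Lemma hpo_left_continuous : continuous (hpo_left R p q).
Proof.
apply: (continuous_compose (f := @cyl_left R F B C) (g := hpo_pi p q)).
  exact: (@existT_continuous _ (@cyl_piece R F B C) (Some true)).
exact: pi_continuous.
Qed.

Lemma hpo_right_continuous : continuous (hpo_right R p q).
Proof.
apply: (continuous_compose (f := @cyl_right R F B C) (g := hpo_pi p q)).
  exact: (@existT_continuous _ (@cyl_piece R F B C) (Some false)).
exact: pi_continuous.
Qed.

Lemma hpo_mid_continuous :
  continuous (fun zt : F * unit_interval R => hpo_mid p q zt.1 zt.2).
Proof.
apply: (continuous_compose
  (f := fun zt : F * unit_interval R => cyl_mid B C zt.1 zt.2)
  (g := hpo_pi p q)); last exact: pi_continuous.
rewrite (_ : (fun _ => _) = existT (@cyl_piece R F B C) None).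
  exact: (@existT_continuous _ (@cyl_piece R F B C) None).
by apply/funext => -[].
Qed.

Lemma continuous_hpo_mid (T : topologicalType) (h : T -> F)
    (t : T -> unit_interval R) :
  continuous h -> continuous t ->
  continuous (fun x => hpo_mid p q (h x) (t x)).
Proof.
move=> ch ct.
exact: continuous_compose (continuous_pair ch ct) hpo_mid_continuous.
Qed.

Lemma hpo_mid0 z : hpo_mid p q z I0 = hpo_left R p q (p z).
Proof.
by apply/eqmodP/asboolP/rst_step; exact: cyl_glue0.
Qed.

Lemma hpo_mid1 z : hpo_mid p q z I1 = hpo_right R p q (q z).
Proof.
by apply/eqmodP/asboolP/rst_step; exact: cyl_glue1.
Qed.

Lemma hpo_ind (S : Q -> Prop) :
  (forall b, S (hpo_left R p q b)) -> (forall c, S (hpo_right R p q c)) ->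
  (forall z t, S (hpo_mid p q z t)) -> forall x, S x.
Proof.
move=> Sl Sr Sm x.
rewrite -[x](@reprK _ {eq_quot cyl_equivrel R p q}).
case: (repr _) => [[[]|] y]; [exact: Sl|exact: Sr|].
by case: y => z t; exact: Sm.
Qed.

(* Multiplication by the unit interval preserves the quotient topology of the *)
(* mapping cylinder: currying turns the homotopy into a map to a path space.  *)
Lemma hpo_homotopic (Z : topologicalType) (f g : Q -> Z)
    (HB : B * unit_interval R -> Z) (HC : C * unit_interval R -> Z)
    (HF : F * unit_interval R * unit_interval R -> Z) :
  continuous HB -> continuous HC -> continuous HF ->
  (forall z u, HF (z, I0, u) = HB (p z, u)) ->
  (forall z u, HF (z, I1, u) = HC (q z, u)) ->
  (forall b, f (hpo_left R p q b) = HB (b, I0)) ->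
  (forall c, f (hpo_right R p q c) = HC (c, I0)) ->
  (forall z t, f (hpo_mid p q z t) = HF (z, t, I0)) ->
  (forall b, g (hpo_left R p q b) = HB (b, I1)) ->
  (forall c, g (hpo_right R p q c) = HC (c, I1)) ->
  (forall z t, g (hpo_mid p q z t) = HF (z, t, I1)) ->
  homotopic R f g.
Proof.
move=> cB cC cF H0 H1 fl fr fm gl gr gm.
have [GB cGB GBE] := path_curry cB.
have [GC cGC GCE] := path_curry cC.
have [GF cGF GFE] := path_curry cF.
pose G := hpo_rec (p := p) (q := q) GB GC (fun z t => GF (z, t)).
have Gpi x : G (hpo_pi p q x) = cyl_rec GB GC (fun z t => GF (z, t)) x.
  apply: hpo_rec_pi => z; apply: path_space_ext => u.
    by rewrite GFE GBE H0.
  by rewrite GFE GCE H1.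
have cG : continuous G.
  apply/quotient_continuous.
  have -> : G \o \pi_(quotient_topology _) =
      cyl_rec GB GC (fun z t => GF (z, t)) by apply/funext => x; exact: Gpi.
  have cGF' : continuous (fun zt : F * unit_interval R => GF (zt.1, zt.2)).
    by rewrite (_ : (fun _ => _) = GF) //; apply/funext => -[].
  case=> [[[]|] x] U /= nU;
    [exact: (cGB _ _ nU)|exact: (cGC _ _ nU)|exact: (cGF' _ _ nU)].
exists (fun xu => path_fun (G xu.1) xu.2); split.
- apply: (continuous_compose (f := fun xu => (G xu.1, xu.2))
    _ (@path_eval_continuous R Z)).
  apply: continuous_pair; last exact: continuous_snd.
  exact: continuous_compose (@continuous_fst _ _) cG.
- by elim/hpo_ind => [b|c|z t] /=; rewrite Gpi/= ?GBE ?GCE ?GFE ?fl ?fr ?fm.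
- by elim/hpo_ind => [b|c|z t] /=; rewrite Gpi/= ?GBE ?GCE ?GFE ?gl ?gr ?gm.
Qed.

End homotopy_pushout.

Ltac continuity :=
  repeat match goal with
  | H : continuous ?f |- continuous ?f => exact: H
  | |- continuous (fun x => x) => exact: continuous_idfun
  | |- continuous (fun _ => ?c) => exact: continuous_const
  | |- continuous (fun x => (@?f x, @?g x)) =>
      apply: (@continuous_pair _ _ _ f g)
  | |- continuous (fun x => GRing.add (@?f x) (@?g x)) =>
      apply: (@continuous_addr _ _ f g)
  | |- continuous (fun x => GRing.opp (@?f x)) =>
      apply: (@continuous_oppr _ _ f)
  | |- continuous (fun x => GRing.mul (@?f x) (@?g x)) =>
      apply: (@continuous_mulr _ _ f g)
  | |- continuous (fun x => Order.max (@?f x) (@?g x)) =>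
      apply: (@continuous_maxr _ _ f g)
  | |- continuous (fun x => Order.min (@?f x) (@?g x)) =>
      apply: (@continuous_minr _ _ f g)
  | |- continuous (fun x => path_fun (hpb_path (@?h x)) (@?t x)) =>
      apply: (@continuous_hpb_eval _ _ _ _ _ _ _ h t)
  | |- continuous (fun x => hpo_mid ?p ?q (@?h x) (@?t x)) =>
      apply: (@continuous_hpo_mid _ _ _ _ p q _ h t)
  | |- continuous (fun x => hpo_left ?R ?p ?q (@?g x)) =>
      apply: (@continuous_compose _ _ _ g _ _ (@hpo_left_continuous R _ _ _ p q))
  | |- continuous (fun x => hpo_right ?R ?p ?q (@?g x)) =>
      apply: (@continuous_compose _ _ _ g _ _ (@hpo_right_continuous R _ _ _ p q))
  | |- continuous (fun x => hpb_fst (@?g x)) =>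
      apply: (@continuous_compose _ _ _ g _ _ (@hpb_fst_continuous _ _ _ _ _ _))
  | |- continuous (fun x => hpb_snd (@?g x)) =>
      apply: (@continuous_compose _ _ _ g _ _ (@hpb_snd_continuous _ _ _ _ _ _))
  | |- continuous (fun x => fst (@?g x)) =>
      apply: (@continuous_compose _ _ _ g _ _ (@continuous_fst _ _))
  | |- continuous (fun x => snd (@?g x)) =>
      apply: (@continuous_compose _ _ _ g _ _ (@continuous_snd _ _))
  | |- continuous (fun x => ival (@?g x)) =>
      apply: (@continuous_compose _ _ _ g _ _ (@ival_continuous _))
  | |- continuous (fun x => clamp (@?g x)) =>
      apply: (@continuous_compose _ _ _ g _ _ (@clamp_cont _))
  | H : continuous ?h |- continuous (fun x => ?h (@?g x)) =>
      apply: (@continuous_compose _ _ _ g h _ H)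
  end.

(** * Homotopy as an equivalence relation compatible with composition *)

Section homotopy.
Local Open Scope ring_scope.
Variables (R : realType) (Y Z : topologicalType).

Lemma homotopic_refl (f : Y -> Z) : continuous f -> homotopic R f f.
Proof. by move=> cf; exists (fun yu => f yu.1); split => //; continuity. Qed.

Lemma homotopic_sym (f g : Y -> Z) : homotopic R f g -> homotopic R g f.
Proof.
move=> [H [cH H0 H1]]; exists (fun yu => H (yu.1, clamp (1 - ival yu.2))).
split => [|y|y]; first by continuity.
- by rewrite /= ival0 clamp_ge1 ?subr0.
- by rewrite /= ival1 clamp_le0 ?subrr.
Qed.

Lemma homotopic_trans (f g h : Y -> Z) :
  homotopic R f g -> homotopic R g h -> homotopic R f h.
Proof.
move=> [H [cH H0 H1]] [K [cK K0 K1]].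
exists (fun yu => if 2 * ival yu.2 - 1 <= 0
  then H (yu.1, clamp (2 * ival yu.2)) else K (yu.1, clamp (2 * ival yu.2 - 1))).
split => [|y|y].
- apply: (@continuous_paste R _ _ (fun yu => 2 * ival yu.2 - 1)
    (fun yu => H (yu.1, clamp (2 * ival yu.2)))
    (fun yu => K (yu.1, clamp (2 * ival yu.2 - 1)))); [by continuity..|].
  move=> -[y u] /= u0.
  by rewrite clamp_ge1 ?clamp_le0 ?H1 ?K0//; lra.
- rewrite /= ival0 ifT; last by lra.
  by rewrite clamp_le0 ?H0//; lra.
- rewrite /= ival1 ifF; last by apply/negbTE; rewrite -ltNge; lra.
  by rewrite clamp_ge1 ?K1//; lra.
Qed.

End homotopy.

Section homotopy_composition.
Variables (R : realType) (W Y Z : topologicalType).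

Lemma homotopic_precomp (k : W -> Y) (f g : Y -> Z) :
  continuous k -> homotopic R f g -> homotopic R (f \o k) (g \o k).
Proof.
move=> ck [H [cH H0 H1]]; exists (fun yu => H (k yu.1, yu.2)); split => [|y|y].
- by continuity.
- by rewrite H0.
- by rewrite H1.
Qed.

End homotopy_composition.

(** * Maps between joins over X that fix A *)

Section join_lift.
Local Open Scope ring_scope.
Variables (R : realType) (X : topologicalType) (E Y A : space_over X).
Notation F := (hpullback R (over_map E) (over_map A)).
Notation I := (unit_interval R).
Notation lE := (@join_left R X E A).
Notation rE := (@join_right R X E A).
Notation lY := (@join_left R X Y A).
Notation rY := (@join_right R X Y A).

(* f sends the segment of E * A from x to a along a path w : x ~> a in X to   *)
(* the segment of Y * A from c x to a along the path v (x, w, a).             *)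
Definition join_lift (c : over_space E -> over_space Y) (v : F * I -> X)
    (f : join_total R E A -> join_total R Y A) : Prop :=
  [/\ forall x, f (lE x) = lY (c x),
      forall a, f (rE a) = rY a &
      forall z t (h : hpullback R (over_map Y) (over_map A)),
        hpb_fst h = c (hpb_fst z) -> hpb_snd h = hpb_snd z ->
        (forall s, path_fun (hpb_path h) s = v (z, s)) ->
        f (hpo_mid _ _ z t) = hpo_mid _ _ h t].

Lemma join_lift_exists c (v : F * I -> X) :
  continuous c -> continuous v ->
  (forall z, v (z, I0) = over_map Y (c (hpb_fst z))) ->
  (forall z, v (z, I1) = over_map A (hpb_snd z)) ->
  exists f, join_lift c v f.
Proof.
move=> cc cv v0 v1.
have [||h [ch hf hs hv]] := @hpb_lift R _ _ _ (over_map Y) (over_map A) _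
  (fun z => c (hpb_fst z)) (fun z => hpb_snd z) v _ _ cv v0 v1.
- by continuity.
- by continuity.
pose f : join_total R E A -> join_total R Y A :=
  hpo_rec (lY \o c) rY
    (fun z t => hpo_mid _ _ (h z) t).
have fpi x : f (hpo_pi _ _ x) =
    cyl_rec (lY \o c) rY
      (fun z t => hpo_mid _ _ (h z) t) x.
  apply: hpo_rec_pi => z; first by rewrite hpo_mid0 hf.
  by rewrite hpo_mid1 hs.
exists f; split => [x|a|z t k kf ks kv]; rewrite ?fpi//=.
by congr hpo_mid; apply: hpb_ext; rewrite ?hf ?hs// => s; rewrite hv kv.
Qed.

(** The left end of each segment moves along [C] while its end in A stays fixed. The path over it
    must follow, so up to homotopy the reverse of the track of [C] in X is put in front of the
    path. *)
Lemma join_lift_homotopic (c0 c1 : over_space E -> over_space Y)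
    (v0 v1 : F * I -> X) f0 f1
    (C : over_space E * I -> over_space Y) (V : F * I * I -> X) :
  join_lift c0 v0 f0 -> join_lift c1 v1 f1 ->
  continuous C -> continuous V ->
  (forall x, C (x, I0) = c0 x) -> (forall x, C (x, I1) = c1 x) ->
  (forall z s, V (z, I0, s) = v0 (z, s)) ->
  (forall z s, V (z, I1, s) = v1 (z, s)) ->
  (forall z u, V (z, u, I0) = over_map Y (C (hpb_fst z, u))) ->
  (forall z u, V (z, u, I1) = over_map A (hpb_snd z)) ->
  homotopic R f0 f1.
Proof.
move=> [f0l f0r f0m] [f1l f1r f1m] cC cV C0 C1 V0 V1 Vs0 Vs1.
have [||[z u]|[z u]|h [ch hf hs hv]] :=
  @hpb_lift R _ _ _ (over_map Y) (over_map A) _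
  (fun zu => C (hpb_fst zu.1, zu.2)) (fun zu => hpb_snd zu.1) V _ _ cV.
- by continuity.
- by continuity.
- exact: Vs0.
- exact: Vs1.
apply: (hpo_homotopic
  (HB := fun xu => lY (C xu))
  (HC := fun au => rY au.1)
  (HF := fun ztu => hpo_mid _ _ (h (ztu.1.1, ztu.2)) ztu.1.2)).
- by rewrite /join_left; continuity.
- by rewrite /join_right; continuity.
- by continuity.
- by move=> z u; rewrite /= hpo_mid0 hf.
- by move=> z u; rewrite /= hpo_mid1 hs.
- by move=> x; rewrite C0; exact: f0l.
- by move=> a; exact: f0r.
- move=> z t; apply: f0m; rewrite ?hf ?hs ?C0// => s.
  by rewrite hv V0.
- by move=> x; rewrite C1; exact: f1l.
- by move=> a; exact: f1r.
- move=> z t; apply: f1m; rewrite ?hf ?hs ?C1// => s.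
  by rewrite hv V1.
Qed.

(* Over a point z = (x, w, a) and for T z t := T of the point of parameter t  *)
(* of the segment of z, the join with a spans a square (t, s), where s is the *)
(* parameter of the segment from T z t to a. The edge s = 0 is join_left \o T,*)
(* the edge t = 0 is f, and the edge s = 1 is constant; the edge t = 1 depends*)
(* only on a. The homotopy pushes the edge s = 0 through the path             *)
(* (0, 0) -> (1, 1) to the edge t = 0 followed by s = 1.                      *)
Lemma join_left_homotopic (T : join_total R E A -> over_space Y)
    (V : F * I * I -> X) (V1 : over_space A * I -> X) f :
  join_lift (fun x => T (lE x)) (fun zs => V (zs.1, I0, zs.2)) f ->
  continuous T -> continuous V -> continuous V1 ->
  (forall z t, V (z, t, I0) = over_map Y (T (hpo_mid _ _ z t))) ->
  (forall z t, V (z, t, I1) = over_map A (hpb_snd z)) ->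
  (forall z s, V (z, I1, s) = V1 (hpb_snd z, s)) ->
  (forall a, V1 (a, I0) = over_map Y (T (rE a))) ->
  (forall a, V1 (a, I1) = over_map A a) ->
  homotopic R (fun y => lY (T y)) f.
Proof.
move=> [fl fr fm] cT cV cV1 Vs0 Vs1 Vt1 V1s0 V1s1.
have [||[z t]|[z t]|h [ch hf hs hv]] :=
  @hpb_lift R _ _ _ (over_map Y) (over_map A) _
  (fun zt : F * I => T (hpo_mid _ _ zt.1 zt.2)) (fun zt => hpb_snd zt.1) V
  _ _ cV.
- by continuity.
- by continuity.
- exact: Vs0.
- exact: Vs1.
have [||h1 [ch1 h1f h1s h1v]] :=
  @hpb_lift R _ _ _ (over_map Y) (over_map A) _
  (fun a => T (rE a)) (fun a => a) V1 _ _ cV1 V1s0 V1s1.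
- by rewrite /join_right; continuity.
- by continuity.
have h1E z : h (z, I1) = h1 (hpb_snd z).
  apply: hpb_ext; rewrite ?hf ?hs ?h1f ?h1s//=; first by rewrite hpo_mid1.
  by move=> s; rewrite hv h1v.
(* As u grows, ([alpha u], [beta u]) runs from (1, 0) through (1, 1) to (0, 1). At time u the
   segment of z is sent to the straight line from (0, 0) to that point of the square. *)
pose alpha (u : I) : R := Num.min 1 (2 - 2 * ival u).
pose beta (u : I) : R := Num.min 1 (2 * ival u).
apply: (hpo_homotopic
  (HB := fun xu => lY (T (lE xu.1)))
  (HC := fun au => hpo_mid _ _ (h1 au.1) (clamp (beta au.2)))
  (HF := fun ztu => hpo_mid _ _
     (h (ztu.1.1, clamp (ival ztu.1.2 * alpha ztu.2)))
     (clamp (ival ztu.1.2 * beta ztu.2)))).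
- by rewrite /join_left; continuity.
- by rewrite /beta; continuity.
- by rewrite /alpha /beta; continuity.
- move=> z u; rewrite /= ival0 !mul0r clamp_le0// hpo_mid0 hf/=.
  by rewrite hpo_mid0.
- move=> z u; rewrite /= ival1 !mul1r.
  (* The end point lies on the edge s = 1 in the second half and on the edge t = 1 in the first; on
     both it depends only on [hpb_snd z], as the gluing demands. *)
  have [u2|u2] := leP (2^-1) (ival u).
    by rewrite [X in hpo_mid _ _ _ X]clamp_ge1 ?[X in _ = hpo_mid _ _ _ X]clamp_ge1
      /beta ?hpo_mid1 ?hs ?h1s// le_min lexx/=; lra.
  by rewrite [X in h (z, X)]clamp_ge1 ?h1E// /alpha le_min lexx/=; lra.
- by [].
- move=> a; rewrite /= clamp_le0 ?hpo_mid0 ?h1f//.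
  by rewrite /beta ival0 ge_min mulr0 lexx orbT.
- move=> z t; rewrite /= /alpha /beta ival0 mulr0 subr0.
  rewrite (_ : Num.min 1 0 = 0 :> R) ?mulr0; last by rewrite min_r.
  rewrite (_ : Num.min 1 2 = 1 :> R) ?mulr1; last by rewrite min_l//; lra.
  by rewrite (@clamp_le0 R 0)// hpo_mid0 hf/= ivalK.
- by move=> x; exact: fl.
- move=> a; rewrite /= /beta ival1 clamp_ge1; last by rewrite le_min lexx/=; lra.
  by rewrite hpo_mid1 h1s; exact: fr.
- move=> z t; rewrite /= /alpha /beta ival1.
  rewrite (_ : Num.min 1 (2 - 2 * 1) = 0 :> R); last by rewrite min_r; lra.
  rewrite (_ : Num.min 1 (2 * 1) = 1 :> R); last by rewrite min_l//; lra.
  rewrite mulr0 mulr1 ivalK (@clamp_le0 R 0)//.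
  by apply: fm => [||s]; rewrite ?hf ?hs ?hv//= hpo_mid0.
Qed.

End join_lift.

(** * Comparing a section with the join of [c] and the identity of A *)

Section join_section.
Local Open Scope ring_scope.
Variables (R : realType) (X : topologicalType) (E Y A : space_over X).
Notation F := (hpullback R (over_map E) (over_map A)).
Notation I := (unit_interval R).
Notation lE := (@join_left R X E A).
Notation lY := (@join_left R X Y A).
Notation q := (over_map E).
Notation p := (over_map Y).
Notation r := (over_map (join_over R E A)).

Lemma join_proj_mid (z : F) (t : I) :
  r (hpo_mid _ _ z t) = path_fun (hpb_path z) t.
Proof. by apply: hpo_rec_pi; [exact: hpb_path0|exact: hpb_path1]. Qed.

Hypothesis cE : continuous q.
Hypothesis cY : continuous p.
Hypothesis cA : continuous (over_map A).
Variables (c : over_space E -> over_space Y) (sigma : X -> over_space Y).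
Hypothesis pc : forall x, p (c x) = q x.
Hypothesis csigma : continuous sigma.
Variables (K : X * I -> X) (L : over_space E * I -> over_space Y).
Hypothesis cK : continuous K.
Hypothesis K0 : forall x, K (x, I0) = p (sigma x).
Hypothesis K1 : forall x, K (x, I1) = x.
Hypothesis cL : continuous L.
Hypothesis L0 : forall x, L (x, I0) = sigma (q x).
Hypothesis L1 : forall x, L (x, I1) = c x.

Definition correction_loop (xs : over_space E * R) : X :=
  if xs.2 + 1 <= 0 then K (q xs.1, clamp (- 1 - xs.2))
  else p (L (xs.1, clamp (1 + xs.2))).

(* The path w of z = (x, w, a) preceded by the loop of correction_loop, which *)
(* runs from q x on [-2, -1] back along K to p (sigma (q x)) and on [-1, 0]   *)
(* along p L to p (c x) = q x. It is needed since the homotopies K \o q and   *)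
(* p \o L from p \o sigma \o q to q need not agree.                           *)
Definition corrected_path (zs : F * R) : X :=
  if zs.2 <= 0 then correction_loop (hpb_fst zs.1, zs.2)
  else path_fun (hpb_path zs.1) (clamp zs.2).

Lemma correction_loop_continuous : continuous correction_loop.
Proof.
apply: (@continuous_paste R _ _ (fun xs : over_space E * R => xs.2 + 1)
  (fun xs => K (q xs.1, clamp (- 1 - xs.2)))
  (fun xs => p (L (xs.1, clamp (1 + xs.2))))); [by continuity..|].
move=> -[x s] /= s0.
by rewrite !clamp_le0 ?K0 ?L0//; lra.
Qed.

(** The constant stretch before -2 leaves time, on [-3, -2], to run K over the fixed point [q x]. *)
Lemma correction_loop_le x s : s <= - 2 -> correction_loop (x, s) = q x.
Proof.
by move=> s2; rewrite /correction_loop/= ifT ?clamp_ge1 ?K1//; lra.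
Qed.

Lemma correction_loopK x s :
  s <= - 1 -> correction_loop (x, s) = K (q x, clamp (- 1 - s)).
Proof. by move=> s1; rewrite /correction_loop/= ifT//; lra. Qed.

Lemma correction_loopL x s :
  - 1 <= s -> correction_loop (x, s) = p (L (x, clamp (1 + s))).
Proof.
move=> s1; rewrite /correction_loop/=; case: ifPn => // s1'.
by rewrite !clamp_le0 ?K0 ?L0//; lra.
Qed.

Lemma correction_loop0 x : correction_loop (x, 0) = q x.
Proof. by rewrite correction_loopL ?clamp_ge1 ?L1 ?pc//; lra. Qed.

Lemma corrected_path_continuous : continuous corrected_path.
Proof.
have cl := correction_loop_continuous.
apply: (@continuous_paste R _ _ (fun zs : F * R => zs.2)
  (fun zs => correction_loop (hpb_fst zs.1, zs.2))
  (fun zs => path_fun (hpb_path zs.1) (clamp zs.2))); [by continuity..|].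
by move=> -[z s] /= ->; rewrite clamp_le0// hpb_path0 correction_loop0.
Qed.

Lemma corrected_path_le z s :
  s <= 0 -> corrected_path (z, s) = correction_loop (hpb_fst z, s).
Proof. by rewrite /corrected_path /= => ->. Qed.

Lemma corrected_path_ge z s :
  0 <= s -> corrected_path (z, s) = path_fun (hpb_path z) (clamp s).
Proof.
rewrite /corrected_path/=; case: ifPn => // s0 s0'.
have -> : s = 0 by apply: le_anti; rewrite s0.
by rewrite correction_loop0 clamp_le0// hpb_path0.
Qed.

Lemma corrected_path1 z : corrected_path (z, 1) = over_map A (hpb_snd z).
Proof. by rewrite corrected_path_ge// clamp_ge1// hpb_path1. Qed.

(** The homotopy passes through lifts [fa], [fb], [fc]. The paths of [fa] amount to K followed by w;
    moving [sigma \o q] along L at once would leave (p L)^-1 K in front of w. Inserting the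
    correction loop first turns them into K, K^-1, p L, w, where K cancels and p L is then absorbed
    by L. *)
Lemma join_section_homotopic f :
  join_lift c (fun zs : F * I => path_fun (hpb_path zs.1) zs.2) f ->
  homotopic R (fun y => lY (sigma (r y))) f.
Proof.
have cr : continuous r by exact: join_proj_continuous.
have cl := correction_loop_continuous.
have cp := corrected_path_continuous.
move=> fP.
have cq : continuous (fun x => sigma (q x)) by continuity.
have [||||fa faP] := @join_lift_exists R X E Y A (fun x => sigma (q x))
  (fun zs => K (path_fun (hpb_path zs.1) zs.2, zs.2)).
- by [].
- by continuity.
- by move=> z; rewrite K0 hpb_path0.
- by move=> z; rewrite K1 hpb_path1.
(* On [0, 1/4] this path is K over [q x]; on [1/4, 1] the second argument of K is 1 and the
   corrected path runs from -2 to 1. *)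
have [||||fb fbP] := @join_lift_exists R X E Y A (fun x => sigma (q x))
  (fun zs => K (corrected_path (zs.1, 4 * ival zs.2 - 3),
                clamp (4 * ival zs.2))).
- by [].
- by continuity.
- move=> z; rewrite /= ival0 clamp_le0; last by lra.
  by rewrite K0 corrected_path_le ?correction_loop_le//; lra.
- move=> z; rewrite /= ival1 clamp_ge1; last by lra.
  by rewrite K1 (_ : 4 * 1 - 3 = 1) ?corrected_path1//; lra.
(* Cutting off at -1 makes the path constant on [0, 1/2]; then come p L and w. *)
have [||||fc fcP] := @join_lift_exists R X E Y A (fun x => sigma (q x))
  (fun zs => corrected_path (zs.1, Num.max (- 1) (4 * ival zs.2 - 3))).
- by [].
- by continuity.
- move=> z; rewrite /= ival0 max_l; last by lra.
  by rewrite corrected_path_le ?correction_loopL ?clamp_le0 ?L0//; lra.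
- move=> z; rewrite /= ival1 max_r; last by lra.
  by rewrite (_ : 4 * 1 - 3 = 1) ?corrected_path1//; lra.
apply: (homotopic_trans (g := fa)).
  (* The maximum of t and s gives w t on s = 0, w s on t = 0, and the end point of w on the other
     two edges, so that t = 1 involves only a. *)
  apply: (@join_left_homotopic R X E Y A (fun y => sigma (r y))
    (fun zts => K (path_fun (hpb_path zts.1.1)
        (clamp (Num.max (ival zts.1.2) (ival zts.2))), zts.2))
    (fun as_ => K (over_map A as_.1, as_.2))).
  - case: faP => fal far fam; split => //.
      by move=> x; rewrite fal join_proj_left.
    move=> z t h hf hs hv; apply: fam => //; first by rewrite hf join_proj_left.
    by move=> s; rewrite hv/= max_r ?ival_ge0// ivalK.
  - by continuity.
  - by continuity.
  - by continuity.
  - by move=> z t; rewrite K0 join_proj_mid /= max_l ?ival_ge0// ivalK.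
  - move=> z t; by rewrite K1/= max_r ?ival_le1// clamp_ge1 ?hpb_path1.
  - move=> z s; by rewrite /= max_l ?ival_le1// clamp_ge1 ?hpb_path1.
  - by move=> a; rewrite K0 join_proj_right.
  - by move=> a; rewrite K1.
apply: (homotopic_trans (g := fb)).
  (* The start of the path retreats from 0 to -3 u on the corrected path, and the left end moves
     along the sigma-image of the loop, a self-homotopy of [sigma \o q]. *)
  apply: (join_lift_homotopic
    (C := fun xu => sigma (correction_loop (xu.1, - (3 * ival xu.2))))
    (V := fun zus => K (corrected_path (zus.1.1,
        ival zus.2 * (1 + 3 * ival zus.1.2) - 3 * ival zus.1.2),
      clamp (ival zus.2 * (1 + 3 * ival zus.1.2)))) faP fbP).
  - by continuity.
  - by continuity.
  - by move=> x; rewrite /= ival0 mulr0 oppr0 correction_loop0.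
  - by move=> x; rewrite /= ival1 correction_loop_le//; lra.
  - move=> z s; rewrite /= ival0 mulr0 addr0 mulr1 subr0.
    by rewrite corrected_path_ge ?ival_ge0// ivalK.
  - by move=> z s; rewrite /= ival1; congr (K (corrected_path (_, _), clamp _)); lra.
  - move=> z u; rewrite /= ival0 mul0r sub0r clamp_le0// K0.
    by rewrite corrected_path_le// oppr_le0 mulr_ge0 ?ival_ge0.
  - move=> z u; rewrite /= ival1 mul1r addrK clamp_ge1 ?K1 ?corrected_path1//.
    by rewrite lerDl mulr_ge0 ?ival_ge0.
apply: (homotopic_trans (g := fc)).
  (* K and its reverse form the tent min (4 s) (2 - 4 s) on [0, 1/2]; truncation at height 1 - u
     flattens it. *)
  apply: (join_lift_homotopic (C := fun xu => sigma (q xu.1))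
    (V := fun zus => if 2 * ival zus.2 - 1 <= 0
      then K (q (hpb_fst zus.1.1),
        clamp (Num.min (Num.min (4 * ival zus.2) (2 - 4 * ival zus.2))
                       (1 - ival zus.1.2)))
      else corrected_path (zus.1.1, 4 * ival zus.2 - 3)) fbP fcP).
  - by continuity.
  - apply: (@continuous_paste R _ _ (fun zus : F * I * I => 2 * ival zus.2 - 1)
      (fun zus => K (q (hpb_fst zus.1.1),
        clamp (Num.min (Num.min (4 * ival zus.2) (2 - 4 * ival zus.2))
                       (1 - ival zus.1.2))))
      (fun zus => corrected_path (zus.1.1, 4 * ival zus.2 - 3)));
      [by continuity..|].
    move=> -[[z u] s] /= s2.
    rewrite clamp_le0 ?K0; last by rewrite !ge_min; apply/orP; left; apply/orP; right; lra.
    by rewrite corrected_path_le ?correction_loopL ?clamp_le0 ?L0//; lra.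
  - by [].
  - by [].
  - move=> z s; rewrite /= ival0; have s0 := ival_ge0 s.
    have [s2|s2] := leP (2 * ival s - 1) 0; last first.
      by rewrite clamp_ge1 ?K1//; lra.
    have [s4|s4] := leP (ival s) 4^-1.
      have s4' : 4 * ival s - 3 <= - 2 by lra.
      rewrite corrected_path_le ?correction_loop_le//; last by lra.
      by rewrite (min_l (y := 2 - _)) ?min_l//; lra.
    have s4' : 4 * ival s - 3 <= - 1 by lra.
    rewrite [X in _ = K (_, X)]clamp_ge1 ?K1; last by lra.
    rewrite corrected_path_le ?correction_loopK//; last by lra.
    rewrite (min_r (x := 4 * _)) ?min_l; [|by lra..].
    by congr (K (_, clamp _)); lra.
  - move=> z s; rewrite /= ival1.
    have [s2|s2] := leP (2 * ival s - 1) 0; last by rewrite max_r//; lra.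
    rewrite clamp_le0 ?K0; last by rewrite ge_min subrr lexx orbT.
    rewrite max_l; last by lra.
    by rewrite corrected_path_le ?correction_loopL ?clamp_le0 ?L0//; lra.
  - move=> z u; rewrite /= ival0 ifT; last by lra.
    by rewrite clamp_le0 ?K0// !ge_min mulr0 lexx.
  - move=> z u; rewrite /= ival1 ifF; last by apply/negbTE; rewrite -ltNge; lra.
    by rewrite (_ : 4 * 1 - 3 = 1) ?corrected_path1//; lra.
(* At time u the path starts at u - 1, where the corrected path is p (L (x, u)); a linear
   reparametrization leads to w. *)
apply: (join_lift_homotopic (C := L)
  (V := fun zus => corrected_path (zus.1.1,
    (1 - ival zus.1.2) * Num.max (- 1) (4 * ival zus.2 - 3) +
    ival zus.1.2 * ival zus.2)) fcP fP) => //.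
- by continuity.
- by move=> z s; rewrite /= ival0 subr0 mul1r mul0r addr0.
- move=> z s; rewrite /= ival1 subrr mul0r add0r mul1r.
  by rewrite corrected_path_ge ?ival_ge0// ivalK.
- move=> z u; rewrite /= ival0 max_l; last by lra.
  rewrite mulr0 addr0 mulrN1 opprB; have := ival_ge0 u; have := ival_le1 u => u1 u0.
  by rewrite corrected_path_le ?correction_loopL ?subrKC ?ivalK//; lra.
- move=> z u; rewrite /= ival1 max_r; last by lra.
  rewrite (_ : _ + _ = 1) ?corrected_path1//; lra.
Qed.

End join_section.

(** * Sections in the Ganea tower *)

Section ganea_inclusions.
Variables (R : realType) (A X : topologicalType) (iota : A -> X).
Hypothesis iota_cont : continuous iota.
Notation G := (ganea_space R iota).
Notation g i := (@ganea_map R A X iota i).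
Notation incl i := (@ganea_incl R A X iota i).

(* Avoids transports along d + k.+1 = d.+1 + k in the codomain of             *)
(* ganea_incl_iter.                                                           *)
Inductive iterated_incl k : forall n, (G k -> G n) -> Prop :=
| iterated_incl0 : iterated_incl id
| iterated_inclS n (f : G k -> G n) :
    iterated_incl f -> iterated_incl (incl n \o f).

Lemma ganea_incl_iter_iterated k d :
  iterated_incl (@ganea_incl_iter R A X iota k d).
Proof.
elim: d => [|d IH]; first exact: iterated_incl0.
exact: iterated_inclS IH.
Qed.

(** Returns from the inductive family to [ganea_incl_iter]; [P] must be general in n because each
    inclusion removed shifts it by one. *)
Lemma iterated_incl_iter k (P : forall n, (G k -> G n) -> Prop) :
  (forall d, P (d + k)%N (@ganea_incl_iter R A X iota k d)) ->
  forall n f, @iterated_incl k n f -> P n f.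
Proof.
move=> PS n f fI; elim: fI P PS => [|m h _ IH] P PS; first exact: (PS 0%N).
by apply: (IH (fun i e => P i.+1 (incl i \o e))) => d; exact: (PS d.+1).
Qed.

Lemma relcat_sectionP k n :
  relcat_section R iota k n <->
  exists gamma : G k -> G n, iterated_incl gamma /\
    exists sigma : X -> G n, [/\ continuous sigma,
      homotopic R (g n \o sigma) id & homotopic R (sigma \o g k) gamma].
Proof.
split=> [[d -> [sigma sP]]|[gamma [gammaI]]].
  by exists (@ganea_incl_iter R A X iota k d); split;
    [exact: ganea_incl_iter_iterated|exists sigma].
elim/iterated_incl_iter: gammaI => d sP.
by exists d.
Qed.

Lemma iterated_incl_continuous k n (f : G k -> G n) :
  iterated_incl f -> continuous f.
Proof.
elim=> [|m h _ ch]; first exact: continuous_idfun.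
exact: continuous_compose ch (@ganea_incl_continuous R A X iota m).
Qed.

Lemma ganea_map_iterated_incl k n (f : G k -> G n) :
  iterated_incl f -> forall x, g n (f x) = g k x.
Proof. by elim=> // m h _ IH x; rewrite /= -IH; exact: join_proj_left. Qed.

Lemma iterated_incl_precomp k n (f : G k.+1 -> G n) :
  iterated_incl f -> iterated_incl (f \o incl k).
Proof.
elim=> [|m h _ IH]; first exact: (iterated_inclS (iterated_incl0 k)).
exact: (iterated_inclS IH).
Qed.

(** For n = k the join of the identity with the identity is the identity. Otherwise the inclusion of
    G_(k+1) into G_n lies strictly over X and restricts to [f] on G_k, so [join_left_homotopic]
    applies with the square w (max t s). *)
Lemma iterated_incl_join_lift k n (f : G k -> G n) :
  iterated_incl f ->
  exists T : G k.+1 -> G n.+1, [/\ iterated_incl T,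
    forall x, T (incl k x) = incl n (f x) &
    forall J, @join_lift R X (ganea R iota k) (ganea R iota n) (Over iota) f
      (fun zs => path_fun (hpb_path zs.1) zs.2) J -> homotopic R T J].
Proof.
elim=> [|m h hI [T [TI TE _]]].
  exists id; split=> [|//|J [Jl Jr Jm]]; first exact: iterated_incl0.
  have -> : J = id.
    apply/funext; elim/hpo_ind => [b|c|z t]; [exact: Jl|exact: Jr|exact: Jm].
  exact/homotopic_refl/continuous_idfun.
have cT := iterated_incl_continuous TI.
exists (incl m.+1 \o T); split=> [|x|J [Jl Jr Jm]].
- exact: iterated_inclS.
- by rewrite /= TE.
apply: (@join_left_homotopic R X (ganea R iota k) (ganea R iota m.+1)
  (Over iota) T
  (fun zts => path_fun (hpb_path zts.1.1)
    (clamp (Num.max (ival zts.1.2) (ival zts.2))))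
  (fun as_ => iota as_.1)).
- split=> [x|//|z t l lf ls lv]; first by rewrite Jl; exact: (congr1 _ (esym (TE x))).
  apply: Jm => //; first by rewrite lf; exact: TE.
  by move=> s; rewrite lv/= max_r ?ival_ge0// ivalK.
- by [].
- by continuity.
- by continuity.
- move=> z t; rewrite /= max_l ?ival_ge0// ivalK.
  exact: (esym (etrans (ganea_map_iterated_incl TI _) (join_proj_mid z t))).
- by move=> z t; rewrite /= max_r ?ival_le1// clamp_ge1 ?hpb_path1.
- by move=> z s; rewrite /= max_l ?ival_le1// clamp_ge1 ?hpb_path1.
- move=> a; apply: (esym (etrans (ganea_map_iterated_incl TI _) _)).
  exact: (@join_proj_right R X (ganea R iota k) (Over iota)).
- by [].
Qed.

Lemma relcat_section_pred k n :
  relcat_section R iota k.+1 n -> relcat_section R iota k n.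
Proof.
move=> /relcat_sectionP[gamma [gammaI [sigma [cs sK sL]]]].
apply/relcat_sectionP; exists (gamma \o incl k).
split; first exact: iterated_incl_precomp.
exists sigma; split=> //.
rewrite (_ : sigma \o g k = (sigma \o g k.+1) \o incl k).
  exact: homotopic_precomp (@ganea_incl_continuous R A X iota k) sL.
by apply/funext => x /=; congr sigma; exact/esym/join_proj_left.
Qed.

Lemma relcat_section_succ k n :
  relcat_section R iota k n -> relcat_section R iota k.+1 n.+1.
Proof.
move=> /relcat_sectionP[gamma [gammaI [sigma [cs [K [cK K0 K1]]
  [L [cL L0 L1]]]]]].
have [T [TI _ TJ]] := iterated_incl_join_lift gammaI.
apply/relcat_sectionP; exists T; split => //.
exists (incl n \o sigma); split.
- exact: continuous_compose cs (@ganea_incl_continuous R A X iota n).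
(* The old homotopy serves again, since g_(n+1) composed with [gamma_n] equals g_n on the nose. *)
- exists K; split=> // x; rewrite K0 /=; exact/esym/join_proj_left.
have cg i := @ganea_map_continuous R A X iota i iota_cont.
have cgamma := iterated_incl_continuous gammaI.
have [||||J JP] := @join_lift_exists R X (ganea R iota k) (ganea R iota n)
  (Over iota) gamma (fun zs => path_fun (hpb_path zs.1) zs.2).
- by [].
- by continuity.
- by move=> z; rewrite hpb_path0; exact/esym/ganea_map_iterated_incl.
- by move=> z; rewrite hpb_path1.
apply: (homotopic_trans (g := J)); last exact/homotopic_sym/TJ.
exact: (@join_section_homotopic R X (ganea R iota k) (ganea R iota n)
  (Over iota) (cg k) (cg n) iota_cont gamma sigma
  (ganea_map_iterated_incl gammaI) cs K L).
Qed.

End ganea_inclusions.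

(** * From sections to the numerical invariant *)

Section relcat.
Local Open Scope ereal_scope.
Variables (R : realType) (A X : topologicalType) (iota : A -> X).

Lemma relcat_le k n :
  relcat_section R iota k n -> relcat R iota k <= n%:Z%:E.
Proof.
move=> kn; rewrite /relcat; case: pselect => [ex|[]]; last first.
  by exists n; exact/asboolP.
by case: ex_minnP => m _ /(_ n (asboolT kn)); rewrite lee_fin lez_nat.
Qed.

Lemma relcatP k :
  relcat R iota k = +oo \/
  exists2 n, relcat_section R iota k n & relcat R iota k = n%:Z%:E.
Proof.
rewrite /relcat; case: pselect => [ex|]; last by left.
by right; case: ex_minnP => m /asboolP km _; exists m.
Qed.

End relcat.

Local Open Scope ereal_scope.

Theorem theorem9 (R : realType) (A X : topologicalType) (iota : A -> X)
    (iota_cont : continuous iota) (k : nat) :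
  relcat R iota k <= relcat R iota k.+1 /\
  relcat R iota k.+1 <= relcat R iota k + 1.
Proof.
split.
  have [->|[n kn ->]] := relcatP R iota k.+1; first exact: leey.
  exact/relcat_le/relcat_section_pred.
have [->|[n kn ->]] := relcatP R iota k; first exact: leey.
rewrite -EFinD addrC -intS.
exact/relcat_le/relcat_section_succ.
Qed.
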